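(* Let $M\in\mathbb{R}^{n\times n}$ be symmetric positive definite and $1\le p\le n$. The vector transport obtained by differentiating the Cayley retraction on $\mathrm{St}_M(n,p)$, $$\mathcal{T}^{\mathcal{R}}_{Z}(Y)=\Big(I-\tfrac12W_{Z}M\Big)^{-1}W_{Y}M\Big(I-\tfrac12W_{Z}M\Big)^{-1}X,\qquad X\in\mathrm{St}_M(n,p),\ Y,Z\in T_X\mathrm{St}_M(n,p),$$ satisfies the Ring–Wirth non-expansive condition with respect to the metric $\langle\xi,\eta\rangle_X=\operatorname{tr}(\xi^\top M\eta)$: for every $X\in\mathrm{St}_M(n,p)$, every $Z\in T_X\mathrm{St}_M(n,p)$ and every $t>0$, $$\big\langle\mathcal{T}^{\mathcal{R}}_{tZ}(Z),\mathcal{T}^{\mathcal{R}}_{tZ}(Z)\big\rangle_{\mathcal{R}_X(tZ)}\le\langle Z,Z\rangle_X .$$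
   Context: $\mathrm{St}_M(n,p)=\{X\in\mathbb{R}^{n\times p}: X^\top MX=I_p\}$, $T_X\mathrm{St}_M(n,p)=\{Z\in\mathbb{R}^{n\times p}:X^\top MZ+Z^\top MX=0\}$. The Riemannian metric at every point $X$ is $\langle\xi,\eta\rangle_X=\operatorname{tr}(\xi^\top M\eta)$. For $X\in\mathrm{St}_M(n,p)$ and $Z\in T_X\mathrm{St}_M(n,p)$: $P_X=I-\tfrac12XX^\top M$, $W_Z=P_XZX^\top-XZ^\top P_X^\top$ (skew-symmetric, linear in $Z$), and the Cayley retraction is $\mathcal{R}_X(Z)=(I-\tfrac12W_ZM)^{-1}(I+\tfrac12W_ZM)X$. *)

(* Defs.v *)
From mathcomp Require Import all_boot all_order all_algebra.
From mathcomp Require Import all_classical all_reals all_analysis.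
Set Implicit Arguments.
Unset Strict Implicit.
Unset Printing Implicit Defensive.
Import Order.TTheory GRing.Theory Num.Theory.
Import numFieldNormedType.Exports.
Local Open Scope ring_scope.

Definition spd (R : realType) (n : nat) (M : 'M[R]_n) : Prop :=
  M^T = M /\ forall x : 'cV[R]_n, x != 0 -> 0 < \tr (x^T *m M *m x).

Definition stiefel (R : realType) (n p : nat) (M : 'M[R]_n)
    (X : 'M[R]_(n, p)) : Prop :=
  X^T *m M *m X = 1%:M.

Definition tangent (R : realType) (n p : nat) (M : 'M[R]_n)
    (X Z : 'M[R]_(n, p)) : Prop :=
  X^T *m M *m Z + Z^T *m M *m X = 0.

(* The value does not depend on the base point X; X is kept as an argument
   because the non-expansive condition compares norms at two points. *)
Definition metric (R : realType) (n p : nat) (M : 'M[R]_n)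
    (X xi eta : 'M[R]_(n, p)) : R :=
  \tr (xi^T *m M *m eta).

Definition PX (R : realType) (n p : nat) (M : 'M[R]_n)
    (X : 'M[R]_(n, p)) : 'M[R]_n :=
  1%:M - 2%:R^-1 *: (X *m X^T *m M).

Definition WZ (R : realType) (n p : nat) (M : 'M[R]_n)
    (X Z : 'M[R]_(n, p)) : 'M[R]_n :=
  PX M X *m Z *m X^T - X *m Z^T *m (PX M X)^T.

(* W_Z is skew-symmetric, so 1 - W_Z M / 2 is invertible whenever M is
   symmetric positive definite, and [invmx] below is the genuine inverse. *)
Definition cayley (R : realType) (n p : nat) (M : 'M[R]_n)
    (X Z : 'M[R]_(n, p)) : 'M[R]_(n, p) :=
  invmx (1%:M - 2%:R^-1 *: (WZ M X Z *m M))
    *m (1%:M + 2%:R^-1 *: (WZ M X Z *m M)) *m X.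

(* [transport M X Z Y] transports Y from the tangent space at X along Z, to
   the tangent space at [cayley M X Z]. *)
Definition transport (R : realType) (n p : nat) (M : 'M[R]_n)
    (X Z Y : 'M[R]_(n, p)) : 'M[R]_(n, p) :=
  invmx (1%:M - 2%:R^-1 *: (WZ M X Z *m M))
    *m (WZ M X Y *m M)
    *m invmx (1%:M - 2%:R^-1 *: (WZ M X Z *m M)) *m X.

(* Main.v *)
Require Import Defs.
From mathcomp Require Import all_boot all_order all_algebra.
From mathcomp Require Import all_classical all_reals all_analysis.
Import Order.TTheory GRing.Theory Num.Theory.
Import numFieldNormedType.Exports.
Set Implicit Arguments.
Unset Strict Implicit.
Unset Printing Implicit Defensive.
Local Open Scope ring_scope.

(** Write [K = W_Z M / 2] and [A = 1 - K].  Since [W_Z] is skew-symmetric and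
    [M] symmetric, [K] is skew-adjoint for the inner product defined by [M],
    that is [K^T M = - M K].  The cross terms of the Gram matrix of [A]
    therefore cancel ([gram_1Bskew]):
    [A^T M A = M + K^T M K], which dominates [M].  Consequently [A] is
    invertible ([unitmx_1Bskew]) and [A^-1] does not increase the [M]-norm
    ([metric_invmx_1Bskew]).

    Derivative.  As [1 + K = 2 - A], the retraction is [(2 A^-1 - 1) X], so only
    an inverse has to be differentiated.  The resolvent identity
    [A_h^-1 - A_0^-1 = A_h^-1 (A_0 - A_h) A_0^-1], where [A_h] is taken at
    [Z + h Y] and is affine in [h], turns the difference quotient into exactly
    [A_h^-1 W_Y M A_0^-1 X] ([cayley_quotient]).  Its limit is the transport
    because inversion of matrices is continuous at invertible matrices
    ([cvg_invmx]).

    Non-expansiveness.  At [t Z], the matrix [A] is affine in [W_Z M], hence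
    commutes with it, and tangency of [Z] gives [W_Z M X = Z] ([WZM_base]).  So
    the transported vector is [A^-1 (A^-1 Z)] ([transport_selfE]), and two
    applications of the contraction [A^-1] give the inequality. *)

(** * Convergence of matrix-valued functions *)

Lemma cvg_mxP (R : realFieldType) (T : Type) (F : set_system T)
    (FF : Filter F) (m n : nat) (f : T -> 'M[R]_(m, n)) (l : 'M[R]_(m, n)) :
  (f x @[x --> F] --> l)%classic <->
  (forall i j, (f x i j @[x --> F] --> l i j)%classic).
Proof.
split=> [fl i j|fl].
  exact: (cvg_comp _ _ fl (@coord_continuous _ _ _ i j l)).
apply/cvgrPdist_le => /= e e0.
near=> x.
rewrite /Num.Def.normr/= mx_normrE (bigmax_le _ (ltW e0))//= => i _.
rewrite !mxE/=.
(* Eventually for every entry: finitely many conditions are intersected. *)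
move: i; near: x; apply: filter_forall => /= i.
exact: ((cvgrPdist_le _ _).1 (fl i.1 i.2)).
Unshelve. all: by end_near. Qed.

Lemma cvg_mulmx (R : realFieldType) (T : Type) (F : set_system T)
    (FF : Filter F) (m n p : nat)
    (f : T -> 'M[R]_(m, n)) (g : T -> 'M[R]_(n, p))
    (a : 'M[R]_(m, n)) (b : 'M[R]_(n, p)) :
  (f x @[x --> F] --> a)%classic -> (g x @[x --> F] --> b)%classic ->
  (f x *m g x @[x --> F] --> a *m b)%classic.
Proof.
move=> /cvg_mxP fa /cvg_mxP gb; apply/cvg_mxP => i j.
under eq_fun do rewrite mxE.
rewrite mxE; apply: cvg_big => [|k _]; first exact: add_continuous.
exact: cvgM.
Qed.

Lemma cvg_determinant (R : realFieldType) (T : Type) (F : set_system T)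
    (FF : Filter F) (n : nat) (f : T -> 'M[R]_n) (a : 'M[R]_n) :
  (f x @[x --> F] --> a)%classic -> (\det (f x) @[x --> F] --> \det a)%classic.
Proof.
move=> /cvg_mxP fa; apply: cvg_big => [|s _]; first exact: add_continuous.
apply: cvgM; first exact: cvg_cst.
by apply: cvg_big => [|i _]; [exact: mul_continuous|exact: fa].
Qed.

(** By Cramer's formula the inverse is the adjugate, whose entries are signed
    minors, divided by a determinant that stays away from zero. *)
Lemma cvg_invmx (R : realFieldType) (T : Type) (F : set_system T)
    (FF : Filter F) (n : nat) (f : T -> 'M[R]_n) (a : 'M[R]_n) :
  a \in unitmx -> (f x @[x --> F] --> a)%classic ->
  (invmx (f x) @[x --> F] --> invmx a)%classic.
Proof.
move=> ua fa.
have da : \det a != 0 by rewrite -unitfE -unitmxE.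
have fda := cvg_determinant FF fa.
have fu : (\forall x \near F,
    (\det (f x))^-1 *: \adj (f x) = invmx (f x))%classic.
  near=> x; rewrite /invmx ifT// unitmxE unitfE; near: x.
  exact: (cvgr_neq0 _ fda da).
apply: cvg_trans (near_eq_cvg fu) _.
rewrite /invmx ua; apply: cvgZ; first exact: cvgV.
apply/cvg_mxP => i j; under eq_fun do rewrite mxE.
rewrite mxE; apply: cvgM; first exact: cvg_cst.
apply: cvg_determinant; apply/cvg_mxP => k l.
under eq_fun do rewrite !mxE.
by rewrite !mxE; move/cvg_mxP : fa; apply.
Unshelve. all: by end_near. Qed.

(** * Skew-adjoint perturbations of the identity *)

Lemma gram_1Bskew (R : nzRingType) (n : nat) (M K : 'M[R]_n) :
  K^T *m M = - (M *m K) ->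
  (1%:M - K)^T *m M *m (1%:M - K) = M + K^T *m M *m K.
Proof.
move=> KM.
have -> : (1%:M - K)^T = 1%:M - K^T by rewrite raddfB/= trmx1.
rewrite mulmxBl mul1mx KM opprK mulmxBr mulmx1 mulmxDl.
by rewrite mulNmx opprD addrA addrK.
Qed.

Section SPD.
Variables (R : realType) (n : nat) (M : 'M[R]_n).
Hypothesis hM : spd M.

Lemma metric_ge0 (p : nat) (X Y : 'M[R]_(n, p)) : 0 <= metric M X Y Y.
Proof.
rewrite /metric /mxtrace; apply: sumr_ge0 => j _.
suff -> : (Y^T *m M *m Y) j j = \tr ((col j Y)^T *m M *m col j Y).
  by have [->|y0] := eqVneq (col j Y) 0;
    [rewrite mulmx0 mxtrace0|rewrite ltW// hM.2].
rewrite trace_mx11 tr_col -row_mul !mxE.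
by apply: eq_bigr => k _; rewrite !mxE.
Qed.

(** A vector killed by [1 - K] is isotropic for [M + K^T M K], which is
    positive definite. *)
Lemma unitmx_1Bskew (K : 'M[R]_n) :
  K^T *m M = - (M *m K) -> 1%:M - K \in unitmx.
Proof.
move=> KM; rewrite -unitmx_tr -row_free_unit; apply: inj_row_free => v vA.
apply/eqP; apply: contraT => v0.
have vT0 : v^T != 0 by rewrite -(inj_eq (@trmx_inj _ _ _)) trmxK trmx0.
have := metric_ge0 v^T (K *m v^T); have := hM.2 _ vT0.
rewrite /metric trmxK trmx_mul trmxK => p1 p2.
suff : \tr (v *m M *m v^T) + \tr (v *m K^T *m M *m (K *m v^T)) = 0.
  by move=> s0; have := ltr_wpDr p2 p1; rewrite s0 ltxx.
rewrite -mxtraceD -(mulmxA v M) !mulmxA -mulmxDl -!(mulmxA v) -mulmxDr.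
by rewrite -gram_1Bskew// !mulmxA vA !mul0mx mxtrace0.
Qed.

(** With [Y = (1 - K) V], the squared norm of [Y] exceeds that of [V] by the
    squared norm of [K V]. *)
Lemma metric_invmx_1Bskew (p : nat) (K : 'M[R]_n) (X Y : 'M[R]_(n, p)) :
  K^T *m M = - (M *m K) ->
  metric M X (invmx (1%:M - K) *m Y) (invmx (1%:M - K) *m Y) <= metric M X Y Y.
Proof.
move=> KM; have uA := unitmx_1Bskew KM.
set V := invmx _ *m Y.
have -> : Y = (1%:M - K) *m V by rewrite mulKVmx.
clearbody V.
rewrite [leRHS]/metric trmx_mul !mulmxA -(mulmxA V^T) -(mulmxA V^T).
rewrite gram_1Bskew// mulmxDr mulmxDl mxtraceD lerDl.
by have := metric_ge0 X (K *m V); rewrite /metric trmx_mul !mulmxA.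
Qed.

End SPD.

(** * The Cayley retraction and its derivative *)

Definition cayley_denom (R : realType) (n p : nat) (M : 'M[R]_n)
    (X Z : 'M[R]_(n, p)) : 'M[R]_n :=
  1%:M - 2%:R^-1 *: (WZ M X Z *m M).

Section Cayley.
Variables (R : realType) (n p : nat) (M : 'M[R]_n).
Hypothesis hM : spd M.
Variable X : 'M[R]_(n, p).

Local Notation A := (cayley_denom M X).

Lemma WZ_linear (h : R) (Y Z : 'M[R]_(n, p)) :
  WZ M X (h *: Y + Z) = h *: WZ M X Y + WZ M X Z.
Proof.
have eT : (h *: Y + Z)^T = h *: Y^T + Z^T by rewrite linearP.
rewrite /WZ eT; move: (PX M X) => P; rewrite !(mulmxDr, mulmxDl).
by rewrite -!scalemxAr -!scalemxAl scalerBr opprD addrACA.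
Qed.

Lemma WZ_skew (Z : 'M[R]_(n, p)) : (WZ M X Z)^T = - WZ M X Z.
Proof. by rewrite /WZ raddfB/= !trmx_mul !trmxK opprB !mulmxA. Qed.

Lemma WZM_skew (a : R) (Z : 'M[R]_(n, p)) :
  (a *: (WZ M X Z *m M))^T *m M = - (M *m (a *: (WZ M X Z *m M))).
Proof.
rewrite linearZ/= trmx_mul hM.1 WZ_skew mulmxN scalerN mulNmx.
by rewrite -scalemxAl -scalemxAr mulmxA.
Qed.

(** The factor 1/2 in [P_X] makes [P_X^T M X = M X / 2], so that
    [W_Z M X = Z - X (X^T M Z + Z^T M X) / 2], where the parenthesis is the
    tangency equation. *)
Lemma WZM_base (Z : 'M[R]_(n, p)) :
  stiefel M X -> tangent M X Z -> WZ M X Z *m M *m X = Z.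
Proof.
rewrite /stiefel /tangent => hX hZ.
have PXMX : (PX M X)^T *m M *m X = 2^-1 *: (M *m X).
  rewrite /PX raddfB/= linearZ/= !trmx_mul !trmxK trmx1 hM.1 !mulmxBl mul1mx.
  rewrite -!scalemxAl -!mulmxA [X^T *m (M *m X)]mulmxA hX mulmx1.
  rewrite -{1}[M *m X]scale1r -scalerBl; congr (_ *: _).
  by rewrite {1}(splitr 1) div1r addrK.
have WMX P : (P *m Z *m X^T - X *m Z^T *m P^T) *m M *m X =
    P *m Z *m (X^T *m M *m X) - X *m Z^T *m (P^T *m M *m X).
  by rewrite !mulmxBl !mulmxA.
rewrite /WZ WMX hX mulmx1 PXMX /PX mulmxBl mul1mx -scalemxAl -scalemxAr.
rewrite -addrA -opprD -scalerDr !mulmxA -!(mulmxA X) -mulmxDr.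
by rewrite hZ mulmx0 scaler0 subr0.
Qed.

Lemma cayley_denom_unit (Z : 'M[R]_(n, p)) : A Z \in unitmx.
Proof. exact/(unitmx_1Bskew hM)/WZM_skew. Qed.

(** The numerator [1 + W_Z M / 2] is 2 minus the denominator, so only an
    inverse depends on [Z]. *)
Lemma cayleyE (Z : 'M[R]_(n, p)) :
  cayley M X Z = (2 *: invmx (A Z) - 1%:M) *m X.
Proof.
rewrite /cayley -/(A Z); congr (_ *m X).
have -> : 1%:M + 2^-1 *: (WZ M X Z *m M) = 2%:M - A Z.
  rewrite /cayley_denom opprB (raddfD (@scalar_mx R n) 1 1)/= -addrA.
  by congr (_ + _); rewrite addrC subrK.
by rewrite mulmxBr mulVmx ?cayley_denom_unit// mul_mx_scalar.
Qed.

Lemma cayley_denomD (h : R) (Y Z : 'M[R]_(n, p)) :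
  A (h *: Y + Z) = A Z - (2^-1 * h) *: (WZ M X Y *m M).
Proof.
rewrite /cayley_denom WZ_linear mulmxDl -scalemxAl scalerDr scalerA opprD.
by rewrite [in RHS]addrAC addrA.
Qed.

(** The resolvent identity gives the difference quotient exactly, with no
    remainder to estimate. *)
Lemma cayley_quotient (h : R) (Y Z : 'M[R]_(n, p)) : h != 0 ->
  h^-1 *: (cayley M X (h *: Y + Z) - cayley M X Z) =
  invmx (A (h *: Y + Z)) *m (WZ M X Y *m M) *m invmx (A Z) *m X.
Proof.
move=> h0; set B := WZ M X Y *m M.
have uA := cayley_denom_unit Z; have uAh := cayley_denom_unit (h *: Y + Z).
have dV : invmx (A (h *: Y + Z)) - invmx (A Z) =
    (2^-1 * h) *: (invmx (A (h *: Y + Z)) *m B *m invmx (A Z)).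
  rewrite scalemxAl scalemxAr.
  have -> : (2^-1 * h) *: B = A Z - A (h *: Y + Z).
    by rewrite cayley_denomD opprB addrC subrK.
  by rewrite mulmxBr mulVmx// mulmxBl mul1mx -mulmxA mulmxV// mulmx1.
rewrite !cayleyE -mulmxBl opprB addrA subrK -scalerBr dV -!scalemxAl !scalerA.
by rewrite mulVKf// mulVf// scale1r.
Qed.

Lemma is_derive_cayley (Y Z : 'M[R]_(n, p)) :
  is_derive Z Y (cayley M X) (transport M X Z Y).
Proof.
suff q : (h^-1 *: ((cayley M X \o shift Z) (h *: Y) - cayley M X Z)
    @[h --> 0^'] --> transport M X Z Y)%classic.
  apply: DeriveDef; last exact: cvg_lim.
  by apply/cvg_ex; exists (transport M X Z Y).
have e : (\forall h \near 0^',
    invmx (A (h *: Y + Z)) *m (WZ M X Y *m M) *m invmx (A Z) *m X =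
    h^-1 *: ((cayley M X \o shift Z) (h *: Y) - cayley M X Z))%classic.
  near=> h; rewrite /= cayley_quotient//; near: h; exact: nbhs_dnbhs_neq.
apply: cvg_trans (near_eq_cvg e) _.
rewrite /transport -/(A Z).
apply: cvg_mulmx (cvg_cst _); apply: cvg_mulmx (cvg_cst _).
apply: cvg_mulmx (cvg_cst _); apply: cvg_invmx; first exact: cayley_denom_unit.
under eq_fun do rewrite cayley_denomD.
suff : (A Z - (2^-1 * h) *: (WZ M X Y *m M) @[h --> 0^'] -->
    A Z - (2^-1 * 0) *: (WZ M X Y *m M))%classic.
  by rewrite mulr0 scale0r subr0.
apply: cvgB; first exact: cvg_cst.
apply: cvgZ; last exact: cvg_cst.
apply: cvgM; first exact: cvg_cst.
exact: cvg_within.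
Unshelve. all: by end_near. Qed.

(** * Transport of a vector along its own direction *)

(** The denominator at [t Z] is affine in [W_Z M], so its inverse commutes with
    [W_Z M]; moving it across leaves [W_Z M X = Z]. *)
Lemma transport_selfE (Z : 'M[R]_(n, p)) (t : R) :
  stiefel M X -> tangent M X Z ->
  transport M X (t *: Z) Z = invmx (A (t *: Z)) *m (invmx (A (t *: Z)) *m Z).
Proof.
move=> hX hZ; rewrite /transport -/(A _); set B := WZ M X Z *m M.
have uA := cayley_denom_unit (t *: Z).
have AB : A (t *: Z) *m B = B *m A (t *: Z).
  rewrite -[t *: Z]addr0 cayley_denomD -/B.
  have -> : A 0 = 1%:M.
    rewrite /cayley_denom /WZ mulmx0 trmx0 !(mul0mx, mulmx0) subr0.
    by rewrite mul0mx scaler0 subr0.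
  by rewrite mulmxBl mulmxBr mul1mx mulmx1 -scalemxAl -scalemxAr.
have BX : B *m X = Z by exact: WZM_base.
clearbody B.
have VB : B *m invmx (A (t *: Z)) = invmx (A (t *: Z)) *m B.
  by rewrite -[LHS](mulKmx uA) [A _ *m (_ *m _)]mulmxA AB mulmxK.
by rewrite -(mulmxA _ B) VB -!mulmxA BX.
Qed.

End Cayley.

Theorem lemma3p2 (R : realType) (n p : nat) (hp : (1 <= p <= n)%N)
    (M : 'M[R]_n) (hM : spd M) :
  (forall X Y Z : 'M[R]_(n, p),
     stiefel M X -> tangent M X Y -> tangent M X Z ->
     is_derive Z Y (cayley M X) (transport M X Z Y)) /\
  (forall (X Z : 'M[R]_(n, p)) (t : R),
     stiefel M X -> tangent M X Z -> 0 < t ->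
     metric M (cayley M X (t *: Z))
       (transport M X (t *: Z) Z) (transport M X (t *: Z) Z)
     <= metric M X Z Z).
Proof.
split=> [X Y Z _ _ _|X Z t hX hZ _]; first exact: is_derive_cayley.
have KM := WZM_skew hM X 2^-1 (t *: Z).
(* The metric is the same form at every base point. *)
rewrite transport_selfE// -[metric M (cayley _ _ _)]/(metric M X).
by apply: le_trans (metric_invmx_1Bskew hM X _ KM) _;
  exact: metric_invmx_1Bskew.
Qed.
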